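(* Let $K$ be a Polish space and let $F\in B_1(K)$. Then the following are equivalent: (1) $F\in \mathrm{PS}(K)$. (2) There exists a (pairwise disjoint) sequence $(V^i)_{i=1}^\infty$ of subsets of $K$, each of which is a difference of two closed subsets of $K$, such that $\bigcup_{i=1}^\infty V^i=K$ and $F|_{V^i}$ is continuous for all $i$. (3) There exists a (pairwise disjoint) sequence $(V^i)_{i=1}^\infty$ of ambiguous subsets of $K$ such that $\bigcup_{i=1}^\infty V^i=K$ and $F|_{V^i}$ is continuous for all $i$. Here the parenthetical requirement ''pairwise disjoint'' in (2) and in (3) may be either included or omitted.
   Context: $C(K)$ is the class of continuous functions $K\to\mathbb{R}$. $B_1(K)$ is the class of functions $f:K\to\mathbb{R}$ of the first Baire class, i.e. pointwise limits of sequences in $C(K)$. A subset of $K$ is ambiguous if it is both an $F_\sigma$ and a $G_\delta$ subset of $K$. $\mathrm{PS}(K)$ is the set of all $f:K\to\mathbb{R}$ for which there is a sequence $(f_n)\subset C(K)$ such that for every $k\in K$ there is an integer $m$ with $f_n(k)=f(k)$ for all $n\ge m$. Restrictions are taken with the relative topology; the sets $V^i$ may be empty. *)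

(* Defs.v *)
From HB Require Import structures.
From mathcomp Require Import all_boot all_order all_algebra.
From mathcomp Require Import all_classical all_reals all_analysis borel_hierarchy.

Set Implicit Arguments.
Unset Strict Implicit.
Unset Printing Implicit Defensive.

Import Order.TTheory GRing.Theory Num.Theory.
Import numFieldNormedType.Exports.

Local Open Scope classical_set_scope.
Local Open Scope ring_scope.

Definition is_metric (R : realType) (K : Type) (d : K -> K -> R) : Prop :=
  [/\ forall x y, 0 <= d x y,
      forall x y, d x y = 0 <-> x = y,
      forall x y, d x y = d y x &
      forall x y z, d x z <= d x y + d y z].

Definition metric_compatible (R : realType) (K : topologicalType)
    (d : K -> K -> R) : Prop :=
  forall x : K,
    nbhs x = filter_from [set e : R | 0 < e] (fun e => [set y | d x y < e]).

(* The limit is taken in the given topology of K, so this is completeness of d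
   only together with [metric_compatible d]. *)
Definition metric_complete (R : realType) (K : topologicalType)
    (d : K -> K -> R) : Prop :=
  forall u : nat -> K,
    (forall e : R, 0 < e -> exists N : nat, forall m n : nat,
       (N <= m)%N -> (N <= n)%N -> d (u m) (u n) < e) ->
    exists l : K, u @ \oo --> l.

Definition completely_metrizable (R : realType) (K : topologicalType) : Prop :=
  exists d : K -> K -> R,
    [/\ is_metric d, metric_compatible d & metric_complete d].

Definition separable_space (K : topologicalType) : Prop :=
  exists2 D : set K, countable D & dense D.

(* [topologicalType] does not require a point: the empty space is Polish. *)
Definition polish (R : realType) (K : topologicalType) : Prop :=
  separable_space K /\ completely_metrizable R K.

Definition baire1 (R : realType) (K : topologicalType) (F : K -> R) : Prop :=
  exists2 f : nat -> K -> R,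
    forall n, continuous (f n) & forall k : K, f ^~ k @ \oo --> F k.

Definition PS (R : realType) (K : topologicalType) (F : K -> R) : Prop :=
  exists2 f : nat -> K -> R,
    forall n, continuous (f n) &
    forall k : K, exists m : nat, forall n : nat, (m <= n)%N -> f n k = F k.

Definition diff_closed (K : topologicalType) (A : set K) : Prop :=
  exists B C : set K, [/\ closed B, closed C & A = B `\` C].

Definition ambiguous (K : topologicalType) (A : set K) : Prop :=
  Fsigma A /\ Gdelta A.

Definition piecewise_continuous (R : realType) (K : topologicalType)
    (P : set K -> Prop) (F : K -> R) : Prop :=
  exists V : nat -> set K,
    [/\ forall i, P (V i),
        \bigcup_i V i = [set: K] &
        forall i, {within V i, continuous F}].

Definition disjoint_piecewise_continuous (R : realType) (K : topologicalType)
    (P : set K -> Prop) (F : K -> R) : Prop :=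
  exists V : nat -> set K,
    [/\ trivIset [set: nat] V,
        forall i, P (V i),
        \bigcup_i V i = [set: K] &
        forall i, {within V i, continuous F}].

(* Main.v *)
Require Import Defs.
From HB Require Import structures.
From mathcomp Require Import all_boot all_order all_algebra.
From mathcomp Require Import all_classical all_reals all_analysis borel_hierarchy.

(** Only the metrizability of K matters.

    If f is a sequence of continuous functions that is eventually equal to F at
    every point, the sets C m of the points where f is constant from the index m
    on are closed and cover K, and F coincides with f m on C m. The sets
    C m `\` (C 0 `|` ... `|` C m.-1) are then disjoint differences of closed sets
    on which F is continuous ([PS_disjoint_diff_closed]).

    In a metrizable space open sets are F_sigma ([metrizable_open_Fsigma]), so
    differences of closed sets are ambiguous; as ambiguous sets form an algebra
    of sets, a cover by such sets can be made disjoint inside their class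
    ([piecewise_ambiguous_disjoint]).

    Conversely, splitting each ambiguous piece into countably many closed sets
    gives closed sets D n that cover K, with F continuous on each of them
    ([piecewise_ambiguous_closed]). By the pasting lemma, F is still continuous on
    the closed set D 0 `|` ... `|` D n.-1, and hence its points where `|F| <= n
    form a closed set E n on which F is continuous and bounded. Metrizable spaces
    are normal, so Tietze's theorem extends F from E n to a continuous function
    f n on K. Since the sets E n increase to K, the sequence f is eventually equal
    to F at every point ([piecewise_closed_PS]). *)

Set Implicit Arguments.
Unset Strict Implicit.
Unset Printing Implicit Defensive.

Import Order.TTheory GRing.Theory Num.Theory.
Import numFieldNormedType.Exports.

Local Open Scope classical_set_scope.
Local Open Scope ring_scope.

(** * Metrizable spaces *)

(** The space K as a pseudometric space, with its own topology and the uniformity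
    of a compatible metric d. *)
Definition metrized (R : realType) (K : topologicalType) (d : K -> K -> R)
  (dmetric : is_metric d) (dK : metric_compatible d) : Type := K.

Section metrized.
Context (R : realType) (K : topologicalType) (d : K -> K -> R).
Hypotheses (dmetric : is_metric d) (dK : metric_compatible d).

Local Notation M := (metrized dmetric dK).

HB.instance Definition _ := Topological.copy M K.

Let ball (x : M) (e : R) : set M := [set y | d x y < e].

Let ball_center x (e : R) : 0 < e -> ball x e x.
Proof.
by case: dmetric => _ d0 _ _; rewrite /ball/= (d0 x x).2.
Qed.

Let ball_sym x y (e : R) : ball x e y -> ball y e x.
Proof. by case: dmetric => _ _ dC _; rewrite /ball/= dC. Qed.

Let ball_triangle x y z (e1 e2 : R) :
  ball x e1 y -> ball y e2 z -> ball x (e1 + e2) z.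
Proof.
case: dmetric => _ _ _ dD; rewrite /ball/= => xy yz.
by rewrite (le_lt_trans (dD x y z))// ltrD.
Qed.

Let nbhs_ball_metric : @nbhs M M = nbhs_ (entourage_ ball).
Proof.
apply/funext => x; rewrite [LHS]dK; apply/seteqP; split => A.
- move=> [e /= e0 eA]; exists [set xy | ball xy.1 e xy.2]; first by exists e.
  by move=> y /xsectionP; exact: eA.
- move=> [E [e /= e0 eE] EA]; exists e => // y xy.
  by apply: EA; apply/xsectionP; exact: (eE (x, y)).
Qed.

(* The first declaration provides the uniform structure, the second one the
   pseudometric structure over it. *)
HB.instance Definition _ := @Nbhs_isPseudoMetric.Build R M (entourage_ ball)
  nbhs_ball_metric ball ball_center ball_sym ball_triangle erefl.
HB.instance Definition _ := @Uniform_isPseudoMetric.Build R M ball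
  ball_center ball_sym ball_triangle erefl.

Lemma metrizable_normal : normal_space K.
Proof. exact: (@pseudometric_normal R M). Qed.

(** An open set U is the union of its closed subsets
    [set x | ball x n.+1%:R^-1 `<=` U]. *)
Lemma metrizable_open_Fsigma (U : set K) : open U -> Fsigma U.
Proof.
move=> oU.
exists (fun n : nat => [set x | ball x n.+1%:R^-1 `<=` U]); last first.
  apply/seteqP; split => [x Ux|x [n _]]; last first.
    by apply; apply: ball_center; rewrite invr_gt0.
  have : nbhs x U by exact: open_nbhs_nbhs.
  rewrite dK => -[e /= e0 eU].
  exists (Num.truncn e^-1) => // y; rewrite /ball/= => xy; apply: eU => /=.
  rewrite (lt_le_trans xy)// -[leRHS]invrK lef_pV2 ?posrE ?invr_gt0//.
  exact/ltW/truncnS_gt.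
move=> n; rewrite -openC openE => x /= /existsNP[y /not_implyP[xy nUy]].
rewrite /interior dK; exists (n.+1%:R^-1 - d x y) => /=; first by rewrite subr_gt0.
move=> z /= xz zU; apply/nUy/zU.
case: dmetric => _ _ dC dD.
by rewrite /ball/= (le_lt_trans (dD z x y))// (dC z x) -ltrBrDr.
Qed.

End metrized.

(** * The algebra of ambiguous sets *)

(** The double sequence C is listed along a surjection from nat to nat * nat. *)
Lemma bigcup_bigcup_seq (T : Type) (C : nat -> nat -> set T) :
  exists2 D : nat -> set T, forall n, exists i j, D n = C i j &
    \bigcup_i \bigcup_j C i j = \bigcup_n D n.
Proof.
pose ij n : nat * nat := odflt (0, 0)%N (unpickle n).
exists (fun n => C (ij n).1 (ij n).2).
  by move=> n; exists (ij n).1, (ij n).2.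
apply/seteqP; split => [x [i _ [j _ Cx]]|x [n _ Cx]].
  by exists (pickle (i, j)) => //; rewrite /ij pickleK.
by exists (ij n).1 => //; exists (ij n).2.
Qed.

Section ambiguous_algebra.
Context {K : topologicalType}.
Implicit Types A B : set K.

Lemma FsigmaC A : Fsigma (~` A) <-> Gdelta A.
Proof.
split=> -[C cC AC]; exists (fun n => ~` C n).
- by move=> n; rewrite openC.
- by rewrite -setC_bigcup -AC setCK.
- by move=> n; rewrite closedC.
- by rewrite AC setC_bigcap.
Qed.

Lemma FsigmaU A B : Fsigma A -> Fsigma B -> Fsigma (A `|` B).
Proof.
move=> [C cC ->] [D cD ->]; exists (fun n => C n `|` D n).
  by move=> n; exact: closedU.
by rewrite bigcupU.
Qed.

Lemma FsigmaI A B : Fsigma A -> Fsigma B -> Fsigma (A `&` B).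
Proof.
move=> [C cC ->] [D cD ->].
have [E EE CDE] := bigcup_bigcup_seq (fun i j => C i `&` D j).
exists E; first by move=> n; have [i [j ->]] := EE n; exact: closedI.
by rewrite -CDE setI_bigcupl; apply: eq_bigcupr => i _; rewrite setI_bigcupr.
Qed.

Lemma ambiguousC A : ambiguous A -> ambiguous (~` A).
Proof. by move=> [FA GA]; split; [exact/FsigmaC|rewrite -FsigmaC setCK]. Qed.

Lemma ambiguousI A B : ambiguous A -> ambiguous B -> ambiguous (A `&` B).
Proof.
move=> [FA GA] [FB GB]; split; first exact: FsigmaI.
by apply/FsigmaC; rewrite setCI; apply: FsigmaU; exact/FsigmaC.
Qed.

Lemma ambiguousU A B : ambiguous A -> ambiguous B -> ambiguous (A `|` B).
Proof.
by move=> aA aB; rewrite -[_ `|` _]setCK setCU; apply/ambiguousC/ambiguousI;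
  exact: ambiguousC.
Qed.

Lemma ambiguousD A B : ambiguous A -> ambiguous B -> ambiguous (A `\` B).
Proof. by move=> aA aB; rewrite setDE; apply/ambiguousI/ambiguousC. Qed.

Lemma ambiguous0 : ambiguous (@set0 K).
Proof. by split; [exact/closed_Fsigma/closed0|exact/open_Gdelta/open0]. Qed.

Lemma ambiguous_seqDU (V : nat -> set K) :
  (forall n, ambiguous (V n)) -> forall n, ambiguous (seqDU V n).
Proof.
move=> aV n; apply: ambiguousD => //.
by apply: big_ind => //; [exact: ambiguous0|exact: ambiguousU].
Qed.

(** This holds in metrizable spaces, and fails in a general topological space. *)
Hypothesis open_Fsigma : forall U : set K, open U -> Fsigma U.

Lemma closed_ambiguous A : closed A -> ambiguous A.
Proof.
move=> cA; split; first exact: closed_Fsigma.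
by apply/FsigmaC/open_Fsigma; rewrite openC.
Qed.

Lemma diff_closed_ambiguous A : diff_closed A -> ambiguous A.
Proof.
by move=> [B [C [cB cC ->]]]; apply: ambiguousD; exact: closed_ambiguous.
Qed.

End ambiguous_algebra.

(** * Piecewise continuity and eventually constant approximation *)

Section piecewise.
Context {R : realType} {K : topologicalType}.
Implicit Type F : K -> R.

Lemma disjoint_piecewise_continuousW (P : set K -> Prop) F :
  disjoint_piecewise_continuous P F -> piecewise_continuous P F.
Proof. by move=> [V [_ PV VT cF]]; exists V. Qed.

Lemma PS_disjoint_diff_closed F :
  PS F -> disjoint_piecewise_continuous (@diff_closed K) F.
Proof.
move=> [f cf fF].
pose C m := [set k | forall n, (m <= n)%N -> f n k = f m k].
have closed_C m : closed (C m).
  rewrite (_ : C m = \bigcap_(n in [set n | (m <= n)%N])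
      ((fun k => f n k - f m k) @^-1` [set 0])); last first.
    apply/seteqP; split => k Ck n mn /=; first by rewrite Ck// subrr.
    by apply/eqP; rewrite -subr_eq0; apply/eqP; exact: Ck.
  apply: closed_bigI => n _; apply: preimage_closed => [k _|].
    by apply: continuousB; exact: cf.
  exact/accessible_closed_set1/hausdorff_accessible/Rhausdorff.
exists (seqDU C); split.
- exact: trivIset_seqDU.
- move=> n; exists (C n), (\big[setU/set0]_(k < n) C k); split => //.
  exact: closed_bigsetU.
- rewrite -seqDU_bigcup_eq -subTset => k _; have [m mF] := fF k.
  by exists m => // n mn; rewrite !mF.
- move=> m; apply: (continuous_subspaceW (@subset_seqDU _ C m)).
  apply: (@subspace_eq_continuous _ _ _ (f m)); last exact/continuous_subspaceT/cf.
  move=> k /set_mem Ck; have [p pF] := fF k.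
  by rewrite -[RHS](pF (maxn m p)) ?leq_maxr// Ck// leq_maxl.
Qed.

Lemma piecewise_ambiguous_disjoint F :
  piecewise_continuous (@ambiguous K) F ->
  disjoint_piecewise_continuous (@ambiguous K) F.
Proof.
move=> [V [aV VT cF]]; exists (seqDU V); split.
- exact: trivIset_seqDU.
- exact: ambiguous_seqDU.
- by rewrite -seqDU_bigcup_eq.
- by move=> i; exact: (continuous_subspaceW (@subset_seqDU _ V i)).
Qed.

Lemma piecewise_ambiguous_closed F :
  piecewise_continuous (@ambiguous K) F -> piecewise_continuous closed F.
Proof.
move=> [V [aV VT cF]].
have /choice[C CV] i : exists C : nat -> set K,
    (forall j, closed (C j)) /\ V i = \bigcup_j C j.
  by have [[C ? ?] _] := aV i; exists C.
have [D DC CD] := bigcup_bigcup_seq C; exists D; split.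
- by move=> n; have [i [j ->]] := DC n; exact: (CV i).1.
- by rewrite -CD -VT; apply: eq_bigcupr => i _; rewrite (CV i).2.
- move=> n; have [i [j ->]] := DC n; apply: continuous_subspaceW (cF i).
  by rewrite (CV i).2; exact: bigcup_sup.
Qed.

Lemma within_bigsetU_continuous (D : nat -> set K) F n :
  (forall i, closed (D i)) -> (forall i, {within D i, continuous F}) ->
  {within \big[setU/set0]_(i < n) D i, continuous F}.
Proof.
move=> cD cF; elim: n => [|n IH].
  by rewrite big_ord0; exact: continuous_subspace0.
by rewrite big_ord_recr; apply: withinU_continuous => //; exact: closed_bigsetU.
Qed.

Lemma closed_within_norm_le (A : set K) F (r : R) :
  closed A -> {within A, continuous F} ->
  closed (A `&` [set k | `|F k| <= r]).
Proof.
move=> cA /continuous_closedP cF; rewrite closed_setSI//.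
rewrite (_ : [set k | _] = F @^-1` `[- r, r]); last first.
  by apply/seteqP; split => k /=; rewrite in_itv/= ler_norml.
by apply: cF; exact: interval_closed.
Qed.

(** Cutting off the points where `|F| is large makes the extension theorem for
    bounded functions sufficient. *)
Lemma piecewise_closed_PS F :
  normal_space K -> piecewise_continuous closed F -> PS F.
Proof.
move=> nK [D [cD DT cF]].
pose U n := \big[setU/set0]_(i < n) D i.
pose E n := U n `&` [set k | `|F k| <= n%:R].
have closed_E n : closed (E n).
  apply: closed_within_norm_le; first exact: closed_bigsetU.
  exact: within_bigsetU_continuous.
have /choice[f fP] n : exists g : K -> R, continuous g /\ {in E n, F =1 g}.
  (* the bound n.+1 is positive even if n = 0 *)
  have [|k [_ /= Fk]|g [Fg cg _]] :=
    continuous_bounded_extension nK (closed_E n) (ltr0Sn R n) (f := F).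
  - apply: continuous_subspaceW (within_bigsetU_continuous cD cF).
    exact: subIsetl.
  - by rewrite (le_trans Fk)// ler_nat.
  - by exists g.
exists f => [n|k]; first exact: (fP n).1.
have [i _ Dik] : (\bigcup_i D i) k by rewrite DT.
exists (maxn i.+1 (Num.truncn `|F k|).+1) => n; rewrite geq_max => /andP[iltn Fn].
apply/esym/(fP n).2/mem_set; split.
  by rewrite /U -bigcup_mkord; exists i.
by rewrite /= (le_trans (ltW (truncnS_gt _)))// ler_nat.
Qed.

End piecewise.

Theorem theorem3p2 (R : realType) (K : topologicalType) (F : K -> R)
    (polishK : polish R K) (F_baire1 : baire1 F) :
  [<-> PS F;
       disjoint_piecewise_continuous (@diff_closed K) F;
       piecewise_continuous (@diff_closed K) F;
       disjoint_piecewise_continuous (@ambiguous K) F;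
       piecewise_continuous (@ambiguous K) F].
Proof.
have [_ [d [dmetric dK _]]] := polishK; tfae.
- exact: PS_disjoint_diff_closed.
- exact: disjoint_piecewise_continuousW.
- move=> [V [dV VT cF]]; apply: piecewise_ambiguous_disjoint; exists V.
  split => // i; apply: diff_closed_ambiguous => //.
  exact: metrizable_open_Fsigma dmetric dK.
- exact: disjoint_piecewise_continuousW.
- move=> /piecewise_ambiguous_closed.
  exact/piecewise_closed_PS/(metrizable_normal dmetric dK).
Qed.
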